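(* Let $K$ be a differential field of characteristic $0$ with algebraically closed field of constants. Then every Picard-Vessiot extension $M$ of $K$ is normal over $K$.
   Context: A differential field is a field with one derivation $y\mapsto y'$; its constants are the elements of derivative zero. For elements $u_1,\dots,u_n$ of a differential extension of $K$, $K(u_1,\dots,u_n)$ denotes the differential subfield generated by $K$ and $u_1,\dots,u_n$. Elements $u_1,\dots,u_n$ that are solutions of a homogeneous linear differential equation of order $n$ over $K$ form a fundamental system of solutions if their wronskian $\det(u_i^{(j-1)})_{1\le i,j\le n}$ is nonzero. A differential extension $M\supseteq K$ is a Picard-Vessiot extension of $K$ if $M=K(u_1,\dots,u_n)$ for a fundamental system of solutions of some homogeneous linear differential equation over $K$ and $M$ has the same field of constants as $K$. A differential extension $M/K$ is normal if for every $z\in M$ with $z\notin K$ there is a differential field automorphism $\sigma$ of $M$ fixing $K$ elementwise such that $\sigma z\neq z$. *)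

(* Defs.v *)
From HB Require Import structures.
From mathcomp Require Import all_boot all_order all_algebra.

Set Implicit Arguments.
Unset Strict Implicit.
Unset Printing Implicit Defensive.

Import GRing.Theory.
Local Open Scope ring_scope.

HB.mixin Record isDiffField F of GRing.Field F := {
  der : F -> F;
  derD : {morph der : x y / x + y};
  derM : forall x y, der (x * y) = der x * y + x * der y
}.

#[short(type="diffFieldType")]
HB.structure Definition DiffField := {F of GRing.Field F & isDiffField F}.

Section Constants.
Variable F : diffFieldType.

Lemma der_is_zmod_morphism : zmod_morphism (@der F).
Proof.
have der0 : der (0 : F) = 0 by apply: (addrI (der 0)); rewrite -derD !addr0.
have derN (x : F) : der (- x) = - der x.
  by apply: (addrI (der x)); rewrite -derD !subrr der0.
by move=> x y; rewrite derD derN.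
Qed.

HB.instance Definition _ :=
  GRing.isZmodMorphism.Build F F (@der F) der_is_zmod_morphism.

Definition is_constant : {pred F} := fun x => der x == 0.

Lemma is_constant_divring_closed : divring_closed is_constant.
Proof.
have der1 : der (1 : F) = 0.
  by apply: (addrI (der 1)); rewrite addr0 -[in RHS](mulr1 1) derM mulr1 mul1r.
split=> [|x y|x y]; rewrite !unfold_in ?der1 // => /eqP dx /eqP dy.
  by rewrite raddfB /= dx dy subr0.
have [->|y0] := eqVneq y 0; first by rewrite invr0 mulr0 raddf0.
apply/eqP/(mulIf y0); rewrite mul0r.
by have := derM (x / y) y; rewrite divfK // dx dy mulr0 addr0.
Qed.

HB.instance Definition _ :=
  GRing.isDivringClosed.Build F is_constant is_constant_divring_closed.

Record constants := Constant {
  constant_val : F;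
  constant_valP : constant_val \in is_constant
}.

HB.instance Definition _ := [isSub for constant_val].
HB.instance Definition _ := [Choice of constants by <:].
HB.instance Definition _ := [SubChoice_isSubIntegralDomain of constants by <:].
HB.instance Definition _ := [SubIntegralDomain_isSubField of constants by <:].

End Constants.

Definition wronskian_mx (F : diffFieldType) n (u : 'I_n -> F) : 'M[F]_n :=
  \matrix_(i, j) iter j der (u i).

Definition wronskian (F : diffFieldType) n (u : 'I_n -> F) : F :=
  \det (wronskian_mx u).

(* Subsets are Prop-valued, so that the intersection defining diff_gen below  *)
(* ranges over all differential subfields and not only the decidable ones.    *)
Record diff_subfield (F : diffFieldType) (S : F -> Prop) : Prop := {
  diff_subfield1 : S 1;
  diff_subfieldB : forall x y, S x -> S y -> S (x - y);
  diff_subfieldM : forall x y, S x -> S y -> S (x * y);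
  diff_subfieldV : forall x, S x -> S x^-1;
  diff_subfield_der : forall x, S x -> S (der x)
}.

(* A differential extension M / K is given by a field morphism iota : K -> M  *)
(* that commutes with the derivations.                                        *)
Definition is_diff_morphism (K M : diffFieldType) (f : K -> M) : Prop :=
  {morph f : x / der x}.

Section Extension.
Variables (K M : diffFieldType) (iota : {rmorphism K -> M}).

Definition diff_gen n (u : 'I_n -> M) (x : M) : Prop :=
  forall S : M -> Prop, diff_subfield S ->
    (forall a, S (iota a)) -> (forall i, S (u i)) -> S x.

(* y is a solution of a_n y^(n) + ... + a_1 y' + a_0 y = 0. *)
Definition lde_solution n (a : 'I_n.+1 -> K) (y : M) : Prop :=
  \sum_(j < n.+1) iota (a j) * iter j der y = 0.

(* The equation has order exactly n when a ord_max != 0. *)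
Definition fundamental_system n (a : 'I_n.+1 -> K) (u : 'I_n -> M) : Prop :=
  [/\ a ord_max != 0, forall i, lde_solution a (u i) & wronskian u != 0].

Definition same_constants : Prop :=
  forall x : M, x \in @is_constant M <->
    exists2 c : K, c \in @is_constant K & iota c = x.

Definition picard_vessiot : Prop :=
  (exists n (a : 'I_n.+1 -> K) (u : 'I_n -> M),
     fundamental_system a u /\ forall x, diff_gen u x)
  /\ same_constants.

Definition normal_extension : Prop :=
  forall z : M, ~ (exists a, iota a = z) ->
    exists sigma : {rmorphism M -> M},
      [/\ bijective sigma, is_diff_morphism sigma,
          forall a, sigma (iota a) = iota a & sigma z != z].

End Extension.

(* Main.v *)
(* Write W for the wronskian matrix of a fundamental system u, so that W' = W B
   with B over K and M = Frac K[W].  If z lies outside K, characteristic 0 gives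
   two embeddings h1, h2 of M over K into a field L with h1 z != h2 z.  They need
   not respect the derivation; put D = h2(W) h1(W)^-1.  A polynomial relation
   P(W) = 0 over K, together with all its derivatives, yields P(Y W) = 0 at
   Y = D with coefficients transported by h1.  The M-span of these polynomials in
   Y is stable under the coefficientwise derivation, hence spanned by polynomials
   over the constants C, all vanishing at D.  The Nullstellensatz over C then
   specialises D to an invertible matrix c over C such that P(W) = 0 implies
   P(c W) = 0, and the same for c^-1 with h1 and h2 exchanged.  So W |-> c W
   defines a differential automorphism of M over K, and c can be chosen so that
   it moves z, because D itself separates h1 z from h2 z. *)

From Stdlib Require Import ClassicalEpsilon.
Require Import Defs.
From HB Require Import structures.
From mathcomp Require Import all_boot all_order all_algebra all_field.
From mathcomp Require Import mpoly.
From mathcomp Require Import ring.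

Set Implicit Arguments.
Unset Strict Implicit.
Unset Printing Implicit Defensive.

Import GRing.Theory.
Local Open Scope ring_scope.

(** * Algebraic elements over a commutative ring *)

Lemma prop_minimum (P : nat -> Prop) :
  (exists n, P n) -> exists2 n, P n & forall m, P m -> (n <= m)%N.
Proof.
case=> n; elim/ltn_ind: n => n IHn Pn.
have [[m Pm lt_mn]|no] := classic (exists2 m, P m & (m < n)%N).
  exact: IHn lt_mn Pm.
by exists n => // m Pm; rewrite leqNgt; apply/negP => lt_mn; apply: no; exists m.
Qed.

(* The kernel of j need not be 0, so that A may be a polynomial ring: points in
   several variables are then reached by replacing A with {poly A}. *)
Section Presentation.
Variables (A : comNzRingType) (M : fieldType) (j : {rmorphism A -> M}).
Implicit Types P Q : {poly A}.

Lemma map_poly_ker (L : comNzRingType) (f : {rmorphism A -> L}) P Q :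
    (forall a, j a = 0 -> f a = 0) ->
  map_poly j P = map_poly j Q -> map_poly f P = map_poly f Q.
Proof.
move=> kerj /eqP; rewrite -subr_eq0 -rmorphB => /eqP eqPQ.
apply/eqP; rewrite -subr_eq0 -rmorphB; apply/eqP/polyP => i.
rewrite coef_map coef0; apply: kerj.
by rewrite -coef_map eqPQ coef0.
Qed.

(** Replaces principality over the fraction field of the image of [j]: an element whose image has
    least size divides the others by pseudo-division, hence the factor [lead_coef g ^+ e]. *)
Lemma pseudo_principal (I : {poly A} -> Prop) :
    (forall P Q, I P -> I Q -> I (P - Q)) ->
    (forall P Q, I P -> I (Q * P)) ->
    (forall P Q, map_poly j P = map_poly j Q -> I P -> I Q) ->
    (exists2 P, I P & map_poly j P != 0) ->
  exists g, [/\ I g, j (lead_coef g) != 0 & forall P, I P ->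
    exists e Q, map_poly j (lead_coef g ^+ e *: P) = map_poly j (Q * g)].
Proof.
move=> IB IM Ij [P0 IP0 P0n0].
have [|n [P [IP Pn0 szP] minn]] := @prop_minimum (fun n => exists P,
    [/\ I P, map_poly j P != 0 & size (map_poly j P) = n]).
  by exists (size (map_poly j P0)), P0.
(* Truncation drops the top coefficients that [j] kills, so that the leading coefficient of [g]
   survives under [j]. *)
pose g := \poly_(i < n) P`_i.
have gP : map_poly j g = map_poly j P.
  apply/polyP => i; rewrite !coef_map coef_poly; case: ltnP => //= le_ni.
  by rewrite raddf0 -coef_map nth_default // szP.
have n_gt0 : (0 < n)%N by rewrite -szP size_poly_gt0.
have jP : j P`_n.-1 != 0.
  by rewrite -coef_map -szP -lead_coefE lead_coef_eq0.
have szg : size g = n.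
  by apply: size_poly_eq; apply: contraNneq jP => ->; rewrite raddf0.
have lg : j (lead_coef g) != 0.
  by rewrite lead_coefE szg coef_poly prednK // leqnn.
exists g; split => // [|Q IQ]; first exact: Ij IP.
case: (Pdiv.ComRing.redivpP Q g) => k q r Dr szr.
have gn0 : g != 0 by rewrite -size_poly_gt0 szg.
exists k, q; rewrite Dr rmorphD /=.
have [->|rn0] := eqVneq (map_poly j r) 0; first by rewrite addr0.
have: (n <= size (map_poly j r))%N.
  apply: minn; exists r; split => //.
  have -> : r = (lead_coef g ^+ k)%:P * Q - q * g by rewrite mul_polyC Dr addrC addKr.
  by apply: IB; apply: IM => //; apply: Ij IP.
by rewrite leqNgt -szg (leq_ltn_trans (size_poly _ _)) // szr.
Qed.

Variable x : M.

(** Here [p] acts as the minimal polynomial of [x]. The last clause is a Bezout identity: [s] and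
    [p] have a common pseudo-divisor [g], which the minimality of [p] forces to be constant. *)
Lemma algebraic_presentation :
    (exists2 P, map_poly j P != 0 & (map_poly j P).[x] = 0) ->
  exists p, [/\ j (lead_coef p) != 0, (map_poly j p).[x] = 0,
    forall P, (map_poly j P).[x] = 0 -> map_poly j P != 0 ->
      (size p <= size (map_poly j P))%N,
    forall P, (map_poly j P).[x] = 0 -> exists e Q,
      map_poly j (lead_coef p ^+ e *: P) = map_poly j (Q * p)
  & forall s, (map_poly j s).[x] != 0 -> exists a b r,
      j r != 0 /\ map_poly j (a * s + b * p) = map_poly j r%:P].
Proof.
case=> P0 P0n0 P0x.
have [||||p [px lp divp]] := @pseudo_principal (fun P => (map_poly j P).[x] = 0).
- by move=> P Q Px Qx; rewrite rmorphB hornerD hornerN Px Qx subr0.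
- by move=> P Q Px; rewrite rmorphM hornerM Px mulr0.
- by move=> P Q ->.
- by exists P0.
have szp P : j (lead_coef P) != 0 -> size (map_poly j P) = size P.
  exact: size_map_poly_id0.
have pn0 : map_poly j p != 0.
  by rewrite -lead_coef_eq0 lead_coefE szp // coef_map -lead_coefE.
have minp P : (map_poly j P).[x] = 0 -> map_poly j P != 0 ->
    (size p <= size (map_poly j P))%N.
  move=> /divp[e [Q eqQ]] Pn0.
  have : map_poly j (lead_coef p ^+ e *: P) != 0.
    by rewrite map_polyZ scaler_eq0 negb_or Pn0 rmorphXn expf_neq0.
  rewrite eqQ rmorphM mulf_eq0 negb_or /= => /andP[Qn0 _].
  have := congr1 (fun P : {poly M} => size P) eqQ.
  rewrite /= map_polyZ size_scale ?rmorphXn ?expf_neq0 // => ->.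
  by rewrite rmorphM size_mul // (szp p) // (polySpred Qn0) addSn leq_addl.
exists p; split => // s sx.
have [||||g [[a [b gab]] lg divg]] := @pseudo_principal (fun P =>
    exists a b, map_poly j P = map_poly j (a * s + b * p)).
- move=> P Q [a [b eqP]] [c [d eqQ]]; exists (a - c), (b - d).
  by rewrite rmorphB /= eqP eqQ -rmorphB; congr map_poly; ring.
- move=> P Q [a [b eqP]]; exists (Q * a), (Q * b).
  by rewrite rmorphM /= eqP -rmorphM; congr map_poly; ring.
- by move=> P Q PQ [a [b eqP]]; exists a, b; rewrite -PQ.
- by exists p => //; exists 0, 1; congr map_poly; ring.
have [|e1 [Q1 eqs]] := divg s; first by exists 1, 0; congr map_poly; ring.
have [|e2 [Q2 eqp]] := divg p; first by exists 0, 1; congr map_poly; ring.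
(* A root of [g] at [x] would be one of [s]. So it is the cofactor [Q2] of [g] in [p] that vanishes
   at [x], and by minimality it has the full size of [p]. *)
have gx : (map_poly j g).[x] != 0.
  have /(congr1 (fun P : {poly M} => P.[x])) /eqP := eqs.
  rewrite map_polyZ rmorphM hornerZ hornerM /=; apply: contraTneq => ->.
  by rewrite mulr0 mulf_eq0 (negPf sx) orbF rmorphXn expf_neq0.
have Q2x : (map_poly j Q2).[x] = 0.
  have /(congr1 (fun P : {poly M} => P.[x])) /eqP := eqp.
  rewrite map_polyZ rmorphM hornerZ hornerM /= px mulr0 eq_sym mulf_eq0.
  by rewrite (negPf gx) orbF => /eqP.
have gQn0 : map_poly j (Q2 * g) != 0.
  by rewrite -eqp map_polyZ scaler_eq0 negb_or pn0 rmorphXn expf_neq0.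
have szQ : size (map_poly j (Q2 * g)) = size p.
  by rewrite -eqp map_polyZ size_scale ?szp ?rmorphXn ?expf_neq0.
have /size1_polyC gC : (size (map_poly j g) <= 1)%N.
  have := gQn0; rewrite rmorphM mulf_eq0 negb_or => /andP[Qn0 gn0].
  have := minp _ Q2x Qn0; rewrite -szQ rmorphM size_mul //.
  rewrite (polySpred gn0) addnS /= -[X in (_ <= X)%N -> _]addn0.
  by rewrite leq_add2l ltnS.
exists a, b, g`_0; split; last by rewrite -gab gC map_polyC /= coef_map.
by apply: contraNneq gx => g0; rewrite gC coef_map /= g0 hornerC.
Qed.

(** Pseudo-division by [p] passes the relations of [x] on to a root [c] of the specialised [p]; the
    Bezout identity reduces nonvanishing of [s] at [c] to one condition [f r != 0] on the base. *)
Lemma algebraic_specialization :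
    (exists2 P, map_poly j P != 0 & (map_poly j P).[x] = 0) ->
  exists p, [/\ j (lead_coef p) != 0, (map_poly j p).[x] = 0,
    forall P, (map_poly j P).[x] = 0 -> map_poly j P != 0 ->
      (size p <= size (map_poly j P))%N,
    forall (L : fieldType) (f : {rmorphism A -> L}) c,
      (forall a, j a = 0 -> f a = 0) -> f (lead_coef p) != 0 ->
      (map_poly f p).[c] = 0 ->
      forall P, (map_poly j P).[x] = 0 -> (map_poly f P).[c] = 0
  & forall s, (map_poly j s).[x] != 0 -> exists2 r, j r != 0 &
      forall (L : fieldType) (f : {rmorphism A -> L}) c,
      (forall a, j a = 0 -> f a = 0) -> (map_poly f p).[c] = 0 ->
      f r != 0 -> (map_poly f s).[c] != 0].
Proof.
case/algebraic_presentation => p [lp px minp divp cop]; exists p; split => //.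
  move=> L f c kerf fl pc P /divp[e [Q /(map_poly_ker kerf)]].
  move=> /(congr1 (fun P : {poly L} => P.[c])) /eqP.
  rewrite map_polyZ rmorphM hornerZ hornerM pc mulr0 mulf_eq0 rmorphXn.
  by rewrite (negPf (expf_neq0 _ fl)) => /eqP.
move=> s /cop[a [b [r [jr eqr]]]]; exists r => // L f c kerf pc.
apply: contraNneq => sc.
have /(congr1 (fun P : {poly L} => P.[c])) := map_poly_ker kerf eqr.
rewrite rmorphD !rmorphM hornerD !hornerM sc pc !mulr0 addr0 map_polyC hornerC.
by move/esym/eqP.
Qed.

Lemma root_lead_coef_size_gt1 p :
  j (lead_coef p) != 0 -> (map_poly j p).[x] = 0 -> (1 < size p)%N.
Proof.
move=> lp px; have szp := size_map_poly_id0 lp.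
rewrite -szp (@root_size_gt1 _ x) //; last exact/rootP.
rewrite -size_poly_gt0 szp size_poly_gt0.
by apply: contraNneq lp => ->; rewrite lead_coef0 rmorph0.
Qed.

End Presentation.

(** * Specialization of points to an algebraically closed field *)

Lemma mpoly_closed (A : comNzRingType) n (S : {mpoly A[n]} -> Prop) :
    (forall a, S a%:MP) -> (forall i, S 'X_i) ->
    (forall P Q, S P -> S Q -> S (P + Q)) ->
    (forall P Q, S P -> S Q -> S (P * Q)) ->
  forall P, S P.
Proof.
move=> SC SX SD SM; elim/mpolyind => [|a m P _ _ SP].
  by rewrite -mpolyC0; apply: SC.
apply: SD => //; rewrite -mul_mpolyC; apply: (SM) => //.
rewrite mpolyXE_id; apply: big_ind => [|P1 P2|i _]; first by rewrite -mpolyC1.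
  exact: SM.
by elim: (m i) => [|k IHk]; rewrite ?expr0 ?exprS -?mpolyC1 //; apply: SM.
Qed.

Lemma mmap_unique (A R : comNzRingType) n (g : {rmorphism {mpoly A[n]} -> R})
    (f : {rmorphism A -> R}) (v : 'I_n -> R) :
  (forall a, g a%:MP = f a) -> (forall i, g 'X_i = v i) -> g =1 mmap f v.
Proof.
move=> gC gX P; elim/mpoly_closed: P => [a|i|P Q eqP eqQ|P Q eqP eqQ].
- by rewrite mmapC.
- by rewrite mmapX mmap1U.
- by rewrite !rmorphD /= eqP eqQ.
- by rewrite !rmorphM /= eqP eqQ.
Qed.

Section HornerHom.
Variables (A R : comNzRingType) (f : {rmorphism A -> R}) (x : R).

Definition horner_hom : {rmorphism {poly A} -> R} :=
  horner_morph (fun a => mulrC x (f a)).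

Lemma horner_homE P : horner_hom P = (map_poly f P).[x].
Proof. by []. Qed.

Lemma horner_homC a : horner_hom a%:P = f a.
Proof. by rewrite horner_homE map_polyC hornerC. Qed.

Lemma horner_homX : horner_hom 'X = x.
Proof. by rewrite horner_homE map_polyX hornerX. Qed.

End HornerHom.

Lemma mpoly0_const (A : comNzRingType) (P : {mpoly A[0]}) : exists a, P = a%:MP.
Proof.
elim/mpoly_closed: P => [a|[]|P Q [a ->] [b ->]|P Q [a ->] [b ->]] //.
- by exists a.
- by exists (a + b); rewrite mpolyCD.
- by exists (a * b); rewrite mpolyCM.
Qed.

Section MpolySplit.
Variables (A : comNzRingType) (n : nat).

Definition mpoly_split_var (i : 'I_n.+1) : {mpoly {poly A}[n]} :=
  if unlift ord0 i is Some i' then 'X_i' else 'X%:MP.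

(** Moves the variable [ord0] into the coefficients, so that inductions on the number of variables
    can enlarge the base ring. *)
Definition mpoly_split : {rmorphism {mpoly A[n.+1]} -> {mpoly {poly A}[n]}} :=
  mmap (@mpolyC n _ \o polyC) mpoly_split_var.

Lemma mpoly_splitC a : mpoly_split a%:MP = a%:P%:MP.
Proof. exact: mmapC. Qed.

Lemma mpoly_splitX i : mpoly_split 'X_i = mpoly_split_var i.
Proof. by rewrite [LHS]mmapX mmap1U. Qed.

Lemma mmap_split (R : comNzRingType) (f : {rmorphism A -> R})
    (v : 'I_n.+1 -> R) (w : 'I_n -> R) P :
    (forall i, v (lift ord0 i) = w i) ->
  mmap f v P = mmap (horner_hom f (v ord0)) w (mpoly_split P).
Proof.
move=> vw; set h := horner_hom _ _.
suff /(_ P) <- : mmap h w \o mpoly_split =1 mmap f v by [].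
apply: mmap_unique => [a|i].
  change (mmap h w (mpoly_split a%:MP) = f a); rewrite mpoly_splitC mmapC.
  exact: horner_homC.
change (mmap h w (mpoly_split 'X_i) = v i).
rewrite mpoly_splitX /mpoly_split_var.
case: unliftP => [i'|] ->; first by rewrite mmapX mmap1U.
by rewrite mmapC; apply: horner_homX.
Qed.

End MpolySplit.
Arguments mpoly_split {A n}.

Section Specialization.
Variables (F C : fieldType).
Hypothesis closedC : GRing.closed_field_axiom C.

(** One-variable step of the Nullstellensatz, as an extension of homomorphisms into [C]: a single
    [r] in the base controls both the existence of [c] and the nonvanishing of [s]. *)
Lemma poly_specialization (A : comNzRingType) (j : {rmorphism A -> F}) (x : F)
    (s : {poly A}) :
  (map_poly j s).[x] != 0 -> exists2 r, j r != 0 &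
    forall f : {rmorphism A -> C}, (forall a, j a = 0 -> f a = 0) -> f r != 0 ->
  exists2 c, forall P, (map_poly j P).[x] = 0 -> (map_poly f P).[c] = 0
    & (map_poly f s).[c] != 0.
Proof.
move=> sx.
have [alg|trans] := classic (exists2 P, map_poly j P != 0 & (map_poly j P).[x] = 0).
  have [p [lp px _ spec /(_ s sx) [r jr nz]]] := algebraic_specialization alg.
  have szp := root_lead_coef_size_gt1 lp px.
  exists (r * lead_coef p) => [|f kerf]; first by rewrite rmorphM mulf_neq0.
  rewrite rmorphM mulf_eq0 negb_or => /andP[fr fl].
  have [|c /rootP fpc] := PreClosedField.closed_rootP closedC (map_poly f p) _.
    by rewrite size_map_poly_id0 // gtn_eqF.
  by exists c; [apply: spec | apply: nz].
(* For transcendental [x] every relation has all its coefficients killed by [j], so [c] only has to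
   avoid the roots of [s]. *)
have [i ji] : exists i, j s`_i != 0.
  have : map_poly j s != 0 by apply: contraNneq sx => ->; rewrite horner0.
  by rewrite -lead_coef_eq0 lead_coefE coef_map; exists (size (map_poly j s)).-1.
exists s`_i => // f kerf fi.
have [|c sc] := PreClosedField.closed_nonrootP closedC (map_poly f s) _.
  by apply: contraNneq fi => s0; rewrite -coef_map s0 coef0.
exists c => // P Px.
have P0 : map_poly j P = 0.
  by apply/eqP/negPn/negP => Pn0; apply: trans; exists P.
have -> : map_poly f P = map_poly f 0.
  by apply: (map_poly_ker kerf); rewrite P0 rmorph0.
by rewrite rmorph0 horner0.
Qed.

(** By induction over the base [{poly A}]: the remaining variables yield a condition in [{poly A}],
    which becomes the [s] of the one-variable step. *)
Lemma mpoly_specialization n (A : comNzRingType) (j : {rmorphism A -> F})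
    (x : 'I_n -> F) (s : {mpoly A[n]}) :
  mmap j x s != 0 -> exists2 r, j r != 0 &
    forall f : {rmorphism A -> C}, (forall a, j a = 0 -> f a = 0) -> f r != 0 ->
  exists2 c, forall P, mmap j x P = 0 -> mmap f c P = 0 & mmap f c s != 0.
Proof.
elim: n => [|n IHn] in A j x s *.
  have [a ->] := mpoly0_const s; rewrite mmapC; exists a => // f kerf fa.
  exists (fun=> 0); last by rewrite mmapC.
  by move=> P; have [b ->] := mpoly0_const P; rewrite !mmapC; apply: kerf.
rewrite (mmap_split j _ (fun=> erefl)).
move=> /IHn[r /poly_specialization[r0 jr0 spec0] spec].
exists r0 => // f kerf fr0; have [c0 ker0 rc0] := spec0 f kerf fr0.
have [//|//|c kerc sc] := spec (horner_hom f c0).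
pose c' i := if unlift ord0 i is Some i' then c i' else c0.
have c'E P : mmap f c' P = mmap (horner_hom f c0) c (mpoly_split P).
  have -> : c0 = c' ord0 by rewrite /c' unlift_none.
  by apply: mmap_split => i; rewrite /c' liftK.
exists c' => [P|]; last by rewrite c'E.
by rewrite (mmap_split j _ (fun=> erefl)) c'E; apply: kerc.
Qed.

End Specialization.

(** * Generic points and separating embeddings *)

Lemma poly_root_extension (F : fieldType) (p : {poly F}) :
  (1 < size p)%N -> exists (L : fieldType) (g : {rmorphism F -> L}) (v : L),
    (map_poly g p).[v] = 0.
Proof.
move=> szp; have [|n [q [szq dvd_qp szn]] minn] :=
    @prop_minimum (fun n => exists q : {poly F},
      [/\ (1 < size q)%N, q %| p & size q = n]).
  by exists (size p), p; rewrite dvdpp.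
have qn0 : q != 0 by rewrite -size_poly_gt0 ltnW.
have irr_q : irreducible_poly q.
  split=> // r szr dvd_rq; rewrite -dvdp_size_eqp // eqn_leq dvdp_leq //= szn.
  apply: minn; exists r; split => //; last exact: dvdp_trans dvd_rq dvd_qp.
  have : r != 0 by apply: contraTneq dvd_rq => ->; rewrite dvd0p.
  by rewrite -size_poly_gt0; case: (size r) szr => [|[]].
have [L _ [v /rootP qv _]] := irredp_FAdjoin irr_q.
exists L, (in_alg L), v; have /dvdpP[r ->] := dvd_qp.
by rewrite rmorphM hornerM qv mulr0.
Qed.

Section FieldExtension.
Variables (A : comNzRingType) (M : fieldType) (j : {rmorphism A -> M}).

(** When [f] has the same kernel as [j], the nonvanishing conditions of the specialization hold
    automatically, so any root of the transported [p] has exactly the relations of [x]. *)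
Lemma algebraic_generic_root (x : M) :
    (exists2 P, map_poly j P != 0 & (map_poly j P).[x] = 0) ->
  exists p : {poly A}, [/\ j (lead_coef p) != 0, (map_poly j p).[x] = 0,
    forall P, (map_poly j P).[x] = 0 -> map_poly j P != 0 ->
      (size p <= size (map_poly j P))%N
  & forall (L : fieldType) (f : {rmorphism A -> L}) (c : L),
    (forall a, j a = 0 <-> f a = 0) -> (map_poly f p).[c] = 0 ->
    forall P, (map_poly j P).[x] = 0 <-> (map_poly f P).[c] = 0].
Proof.
move=> /algebraic_specialization[p [lp px minp spec nz]]; exists p.
split => // L f c kerf pc P; have ker1 a : j a = 0 -> f a = 0 by move/kerf.
have ker2 a : j a != 0 -> f a != 0 by apply: contra_neq => /kerf.
split; first by apply: spec => //; apply: ker2.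
move=> Pc; apply/eqP/negPn/negP => /nz[r /ker2 fr] /(_ L f c ker1 pc fr).
by rewrite Pc eqxx.
Qed.

(** The indeterminate of the rational function field over [F] serves as [v]. *)
Lemma transcendental_generic_root (x : M) (F : fieldType) (k : {rmorphism A -> F}) :
    ~ (exists2 P, map_poly j P != 0 & (map_poly j P).[x] = 0) ->
    (forall a, j a = 0 <-> k a = 0) ->
  exists (L : fieldType) (g : {rmorphism F -> L}) (v : L),
    (forall y, g y != v) /\
    forall P, (map_poly j P).[x] = 0 <-> (map_poly (g \o k) P).[v] = 0.
Proof.
move=> trans kerk.
exists {fraction {poly F}}, (@FracField.tofrac _ \o polyC), (FracField.tofrac 'X).
split=> [y|P] /=.
  rewrite tofrac_eq; apply/eqP => yX; have := size_polyX F.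
  by rewrite -yX size_polyC; case: (_ == 0).
have -> : map_poly ((@FracField.tofrac _ \o polyC) \o k) P
    = map_poly (@FracField.tofrac _) (map_poly polyC (map_poly k P)).
  by rewrite -!map_poly_comp.
rewrite horner_map /= -/(comp_poly _ _) comp_polyXr.
have -> : (FracField.tofrac (map_poly k P) = 0 <-> map_poly k P = 0).
  by split=> [/eqP|->]; [rewrite tofrac_eq0 => /eqP | exact: rmorph0].
split=> [Px|/polyP P0].
  have -> : map_poly k P = map_poly k 0; last exact: rmorph0.
  apply: (map_poly_ker (j := j)) => [a /kerk|] //; rewrite rmorph0.
  by apply/eqP/negPn/negP => Pn0; apply: trans; exists P.
have -> : map_poly j P = 0; last exact: horner0.
by apply/polyP => i; rewrite coef_map coef0; apply/kerk; rewrite -coef_map P0 coef0.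
Qed.

Lemma generic_root (x : M) (F : fieldType) (k : {rmorphism A -> F}) :
    (forall a, j a = 0 <-> k a = 0) ->
  exists (L : fieldType) (g : {rmorphism F -> L}) (v : L),
    forall P, (map_poly j P).[x] = 0 <-> (map_poly (g \o k) P).[v] = 0.
Proof.
move=> kerk.
have [alg|trans] := classic (exists2 P, map_poly j P != 0 & (map_poly j P).[x] = 0).
  have [p [lp px _ gen]] := algebraic_generic_root alg.
  have klp : k (lead_coef p) != 0 by apply: contra_neq lp => /kerk.
  have [|L [g [v pv]]] := @poly_root_extension F (map_poly k p).
    by rewrite size_map_poly_id0 // (root_lead_coef_size_gt1 lp px).
  exists L, g, v; apply: gen => [a|]; last by rewrite map_poly_comp.
  split=> [/kerk /= ->|/=/eqP]; first exact: rmorph0.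
  by rewrite fmorph_eq0 => /eqP/kerk.
have [L [g [v [_ gen]]]] := transcendental_generic_root trans kerk.
by exists L, g, v.
Qed.

End FieldExtension.

Lemma eq_mmap (A R : comNzRingType) n (f f' : {rmorphism A -> R}) (v v' : 'I_n -> R) P :
  f =1 f' -> v =1 v' -> mmap f v P = mmap f' v' P.
Proof.
move=> eqf eqv; apply: (mmap_unique (g := mmap f v)) => [a|i].
  by rewrite [LHS]mmapC; apply: eqf.
by rewrite [LHS]mmapX mmap1U; apply: eqv.
Qed.

(** Extends the isomorphism between the images of [j] and [k] to the coordinates of [x] one at a
    time, enlarging the target field; each treated coordinate joins the base ring. *)
Lemma generic_point n (A : comNzRingType) (M F : fieldType) (j : {rmorphism A -> M})
    (k : {rmorphism A -> F}) (x : 'I_n -> M) :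
    (forall a, j a = 0 <-> k a = 0) ->
  exists (L : fieldType) (g : {rmorphism F -> L}) (v : 'I_n -> L),
    forall P, mmap j x P = 0 <-> mmap (g \o k) v P = 0.
Proof.
elim: n => [|n IHn] in A F j k x * => kerk.
  exists F, idfun, (fun=> 0) => P; have [a ->] := mpoly0_const P.
  by rewrite !mmapC; exact: (kerk a).
have [L1 [g1 [v1 gen1]]] := generic_root (x ord0) kerk.
have [L [g [w gen]]] := IHn _ _ (horner_hom j (x ord0)) (horner_hom (g1 \o k) v1)
  (fun i => x (lift ord0 i)) gen1.
pose v i := if unlift ord0 i is Some i' then w i' else g v1.
exists L, (g \o g1), v => P.
rewrite (mmap_split j _ (fun=> erefl)) gen.
rewrite (mmap_split (w := w) ((g \o g1) \o k)) => [|i]; last by rewrite /v liftK.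
have v0 : v ord0 = g v1 by rewrite /v unlift_none.
suff eq_gh : g \o horner_hom (g1 \o k) v1 =1 horner_hom ((g \o g1) \o k) (v ord0).
  by rewrite (eq_mmap _ eq_gh (frefl w)).
by move=> Q; rewrite horner_homE v0 (map_poly_comp g) horner_map.
Qed.

(** If [z] is algebraic, characteristic 0 makes it a simple root of its minimal polynomial, which is
    not linear because [z] lies outside [K]; a root of the cofactor is the required conjugate. If
    not, [z] goes to an indeterminate. *)
Lemma distinct_generic_root (K M : fieldType) (iota : {rmorphism K -> M}) (z : M) :
    [pchar K] =i pred0 -> ~ (exists a, iota a = z) ->
  exists (L : fieldType) (g : {rmorphism M -> L}) (v : L), g z != v /\
    forall P, (map_poly iota P).[z] = 0 <-> (map_poly (g \o iota) P).[v] = 0.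
Proof.
move=> /pcharf0P char0 zK.
have [alg|trans] := classic (exists2 P, map_poly iota P != 0 & (map_poly iota P).[z] = 0).
  have [p [lp pz minp gen]] := algebraic_generic_root alg.
  have szp := root_lead_coef_size_gt1 lp pz.
  have pn0 : p != 0 by rewrite -size_poly_gt0 ltnW.
  have /factor_theorem[q Dq] : root (map_poly iota p) z by apply/rootP.
  have dp_n0 : p^`() != 0.
    (* The coefficient of the derivative at this index is [lead_coef p] times the degree
       [(size p).-1]. *)
    apply/eqP => /polyP/(_ (size p).-2)/eqP.
    rewrite coef_deriv coef0 -mulr_natr mulf_eq0 char0 orbF.
    case: (size p) szp (lead_coefE p) => [|[|m]] // _ /= <-.
    by rewrite lead_coef_eq0 (negPf pn0).
  have qz : q.[z] != 0.
    apply/eqP => qz; have : (size p <= size (map_poly iota p^`()))%N.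
      apply: minp; last by rewrite map_poly_eq0.
      rewrite -deriv_map Dq derivM hornerD !hornerM qz mul0r addr0.
      by rewrite hornerXsubC subrr mulr0.
    by rewrite size_map_poly leqNgt lt_size_deriv.
  have qn0 : q != 0 by apply: contraNneq qz => ->; rewrite horner0.
  have szpq : size p = (size q).+1.
    by rewrite -(size_map_poly iota) Dq size_mul ?polyXsubC_eq0 // size_XsubC addn2.
  have szq : (1 < size q)%N.
    rewrite ltn_neqAle size_poly_gt0 qn0 andbT; apply/eqP => szq1; apply: zK.
    have p1 : p`_1 != 0.
      by have := lead_coef_eq0 p; rewrite lead_coefE szpq -szq1 /= => ->.
    exists (- p`_0 / p`_1); apply: (mulIf (_ : iota p`_1 != 0)).
      by rewrite fmorph_eq0.
    rewrite -rmorphM divfK //; apply/eqP; rewrite eq_sym -subr_eq0 rmorphN opprK -pz.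
    rewrite horner_coef size_map_poly szpq -szq1 !big_ord_recl big_ord0 !coef_map.
    by apply/eqP; rewrite /= expr0 expr1; ring.
  have [L [g [v qv]]] := poly_root_extension szq.
  exists L, g, v; split.
    apply: contra_neq qz => gz; apply: (fmorph_inj g).
    by rewrite -horner_map gz qv rmorph0.
  apply: gen => [a|]; last by rewrite map_poly_comp Dq rmorphM hornerM qv mul0r.
  by split=> [/= ->|/= /eqP]; [exact: rmorph0 | rewrite fmorph_eq0 => /eqP].
have [L [g [v [gv gen]]]] := transcendental_generic_root trans (fun a : K => iff_refl _).
by exists L, g, v.
Qed.

(** Equality of kernels makes [k a / k b] independent of the fraction [j a / j b] representing [y];
    indefinite description selects one. *)
Lemma fraction_morphism (A : comNzRingType) (M F : fieldType) (j : {rmorphism A -> M})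
    (k : {rmorphism A -> F}) :
    (forall a, j a = 0 <-> k a = 0) ->
    (forall y, exists a b, j b != 0 /\ y * j b = j a) ->
  exists h : {rmorphism M -> F}, forall a, h (j a) = k a.
Proof.
move=> kerk frac.
have ker2 a : j a != 0 -> k a != 0 by apply: contra_neq => /kerk.
pose ex y := constructive_indefinite_description _ (frac y).
pose h y := let: exist a ab := ex y in
  k a / k (projT1 (constructive_indefinite_description _ ab)).
have hE y a b : j b != 0 -> y * j b = j a -> h y = k a / k b.
  move=> b0 yb; rewrite /h; case: (ex y) => a' ab'.
  case: (constructive_indefinite_description _ ab') => b' /= [b'0 yb'].
  apply/eqP; rewrite eqr_div ?ker2 // -!rmorphM -subr_eq0 -rmorphB; apply/eqP/kerk.
  by rewrite rmorphB !rmorphM -yb -yb'; ring.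
have hA : zmod_morphism h.
  move=> y y'; have [a [b [b0 yb]]] := frac y; have [a' [b' [b'0 yb']]] := frac y'.
  rewrite (hE y a b) // (hE y' a' b') // (hE _ (a * b' - a' * b) (b * b')).
  - by rewrite rmorphB !rmorphM; field; rewrite !ker2.
  - by rewrite rmorphM mulf_neq0.
  - by rewrite rmorphB !rmorphM -yb -yb'; ring.
have hM : monoid_morphism h.
  split; first by rewrite (hE _ 1 1) ?rmorph1 ?mulr1 ?divr1 ?oner_neq0.
  move=> y y'; have [a [b [b0 yb]]] := frac y; have [a' [b' [b'0 yb']]] := frac y'.
  rewrite (hE y a b) // (hE y' a' b') // (hE _ (a * a') (b * b')).
  - by rewrite !rmorphM; field; rewrite !ker2.
  - by rewrite rmorphM mulf_neq0.
  - by rewrite !rmorphM -yb -yb'; ring.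
pose hR : {rmorphism M -> F} := HB.pack h
  (GRing.isZmodMorphism.Build M F h hA) (GRing.isMonoidMorphism.Build M F h hM).
exists hR => a; change (h (j a) = k a).
by rewrite (hE _ a 1) rmorph1 ?mulr1 ?divr1 ?oner_neq0.
Qed.

Lemma rmorph_mmap (A R S : comNzRingType) n (g : {rmorphism R -> S})
    (f : {rmorphism A -> R}) (v : 'I_n -> R) P :
  g (mmap f v P) = mmap (g \o f) (g \o v) P.
Proof.
apply: (mmap_unique (g := g \o mmap f v)) => [a|i].
  by rewrite [LHS]/= mmapC.
by rewrite [LHS]/= mmapX mmap1U.
Qed.

Lemma mmap_map_mpoly (A R S : comNzRingType) n (g : {rmorphism R -> S})
    (f : {rmorphism A -> R}) (v : 'I_n -> S) P :
  mmap g v (map_mpoly f P) = mmap (g \o f) v P.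
Proof.
apply: (mmap_unique (g := mmap g v \o map_mpoly f)) => [a|i].
  by change (mmap g v (map_mpoly f a%:MP) = g (f a)); rewrite map_mpolyC mmapC.
by change (mmap g v (map_mpoly f 'X_i) = v i); rewrite map_mpolyX mmapX mmap1U.
Qed.

(** First [z] is sent to a conjugate [v1], then [x] to a generic point over that choice. The
    resulting embedding is [h2], with [h2 z = g v1], while [h1] is [g \o g1]. *)
Lemma separating_embeddings (K M : fieldType) (iota : {rmorphism K -> M}) (z : M)
    n (x : 'I_n -> M) :
    [pchar K] =i pred0 -> ~ (exists a, iota a = z) ->
    (forall y, exists P Q, mmap iota x Q != 0 /\ y * mmap iota x Q = mmap iota x P) ->
  exists (L : fieldType) (h1 h2 : {rmorphism M -> L}),
    h1 \o iota =1 h2 \o iota /\ h1 z != h2 z.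
Proof.
move=> char0 zK frac.
have [L1 [g1 [v1 [gz1 gen1]]]] := distinct_generic_root char0 zK.
have [L [g [v gen]]] := generic_point x
  (gen1 : forall P, horner_hom iota z P = 0 <-> horner_hom (g1 \o iota) v1 P = 0).
have evC P : mmap (horner_hom iota z) x (map_mpoly polyC P) = mmap iota x P.
  by rewrite mmap_map_mpoly; apply: eq_mmap => // a; apply: horner_homC.
have [|h2 h2E] := fraction_morphism gen.
  by move=> y; have [P [Q]] := frac y; rewrite -!evC => PQ;
    exists (map_mpoly polyC P), (map_mpoly polyC Q).
have {}h2E P : h2 (map_poly iota P).[z] = g (map_poly (g1 \o iota) P).[v1].
  by have := h2E P%:MP; rewrite [LHS]/= [RHS]/= !mmapC.
exists L, (g \o g1), h2; split=> [a|].
  by have := h2E a%:P; rewrite !map_polyC !hornerC => /= <-.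
by have := h2E 'X; rewrite !map_polyX !hornerX => ->; rewrite /= (inj_eq (fmorph_inj g)).
Qed.

(** * Descent to constant coefficients *)

Section ConstantSpan.
Variables (M : diffFieldType) (N : nat).
Implicit Types P Q : {mpoly M[N]}.

Lemma size_msupp_lt P Q m :
    P@_m != 0 -> Q@_m = 0 -> (forall m', P@_m' = 0 -> Q@_m' = 0) ->
  (size (msupp Q) < size (msupp P))%N.
Proof.
move=> Pm Qm PQ; have mP : m \in msupp P by rewrite mcoeff_msupp.
rewrite (perm_size (perm_to_rem mP)) ltnS uniq_leq_size ?msupp_uniq // => m'.
rewrite mem_rem_uniq ?msupp_uniq // inE /= !mcoeff_msupp => Qm'.
rewrite (contra_neq (PQ m') Qm') andbT; apply: contraNneq Qm' => ->.
exact/eqP.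
Qed.

(* Normalise an element of minimal support in J to have a coefficient 1: its
   derivative has smaller support, so it is 0. *)
Lemma constant_span (J S : {mpoly M[N]} -> Prop) :
    (forall P Q, J P -> J Q -> J (P + Q)) -> (forall a P, J P -> J (a *: P)) ->
    (forall P, J P -> J (map_mpoly der P)) ->
    S 0 -> (forall P Q, S P -> S Q -> S (P + Q)) -> (forall a P, S P -> S (a *: P)) ->
    (forall P, J P -> (forall m, der P@_m = 0) -> S P) ->
  forall P, J P -> S P.
Proof.
move=> JD JZ Jd S0 SD SZ JS P; move: {2}(size _) (leqnn (size (msupp P))) => k.
elim: k P => [|k IHk] P szP JP.
  by move: szP; rewrite leqn0 size_eq0 msupp_eq0 => /eqP ->.
have [->//|Pn0] := eqVneq P 0.
(* Keeping the support of [Q] inside that of [P] ensures that subtracting a multiple of [Q1] from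
   [P] removes the monomial [m] and adds none. *)
have [|n [Q [JQ Qn0 QP szQ]] minn] := @prop_minimum (fun n => exists Q,
    [/\ J Q, Q != 0, forall m, P@_m = 0 -> Q@_m = 0 & size (msupp Q) = n]).
  by exists (size (msupp P)), P.
have [m Qm] : exists m, Q@_m != 0.
  by exists (mlead Q); rewrite -/(mleadc _) mleadc_eq0.
pose Q1 := (Q@_m)^-1 *: Q; have JQ1 : J Q1 by apply: JZ.
have Q1m : Q1@_m = 1 by rewrite mcoeffZ mulVf.
have SQ1 : S Q1.
  apply: JS => // m'; apply/eqP/negPn/negP => dQm'.
  have d1 : der (1 : M) = 0.
    by apply: (addrI (der 1)); rewrite addr0 -[in RHS](mulr1 1) derM mulr1 mul1r.
  have dQ m1 : Q@_m1 = 0 -> (map_mpoly der Q1)@_m1 = 0.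
    by move=> Qm1; rewrite mcoeff_map_mpoly mcoeffZ Qm1 mulr0 raddf0.
  have : (n <= size (msupp (map_mpoly der Q1)))%N.
    apply: minn; exists (map_mpoly der Q1); split => //; first exact: Jd.
      by apply: contraNneq dQm' => dQ0; rewrite -mcoeff_map_mpoly dQ0 mcoeff0.
    by move=> m1 /QP/dQ.
  rewrite leqNgt -szQ (@size_msupp_lt _ _ m) //.
  by rewrite mcoeff_map_mpoly Q1m; exact: d1.
have -> : P = (P - P@_m *: Q1) + P@_m *: Q1 by rewrite subrK.
apply: SD; last exact: SZ.
apply: IHk; last by rewrite -scaleNr; apply: JD => //; apply: JZ.
have Pm : P@_m != 0 by apply: contra_neq Qm => /QP.
rewrite -ltnS (leq_trans _ szP) // (@size_msupp_lt _ _ m) //.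
  by rewrite mcoeffB mcoeffZ Q1m mulr1 subrr.
by move=> m' Pm'; rewrite mcoeffB !mcoeffZ Pm' (QP _ Pm') !mulr0 subr0.
Qed.

End ConstantSpan.

Lemma mpoly_lift (R S : comNzRingType) n (f : {rmorphism R -> S}) (P : {mpoly S[n]}) :
  (forall m, exists a, f a = P@_m) -> exists Q, map_mpoly f Q = P.
Proof.
elim/mpolyind: P => [|a m P mP a0 IHP] coefP; first by exists 0; rewrite rmorph0.
have [m'|Q <-] := IHP.
  have [->|nm] := eqVneq m' m.
    by exists 0; rewrite rmorph0; apply/esym/eqP; rewrite mcoeff_eq0.
  have [b fb] := coefP m'; exists b.
  by rewrite fb mcoeffD mcoeffZ mcoeffX eq_sym (negPf nm) mulr0 add0r.
have [b fb] := coefP m; exists (b *: 'X_[m] + Q).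
rewrite rmorphD /= map_mpolyZ map_mpolyX fb mcoeffD mcoeffZ mcoeffX eqxx mulr1.
by move: mP; rewrite -mcoeff_eq0 => /eqP ->; rewrite addr0.
Qed.

(** Writing [d] with as few terms [a i *: map_mpoly f (q i)] as possible makes the [a i] independent
    over [C]. So [d] vanishes at a point over [C] only if all [q i] do, and [s] is a [q i] that is
    nonzero at [v]. *)
Lemma linear_specialization (C M L : fieldType) (f : {rmorphism C -> M})
    (h : {rmorphism M -> L}) N (v : 'I_N -> L) (d : {mpoly M[N]}) :
  mmap h v d != 0 -> exists2 s : {mpoly C[N]}, mmap (h \o f) v s != 0 &
    forall c : 'I_N -> C, mmap idfun c s != 0 -> mmap idfun (f \o c) d != 0.
Proof.
move=> dv; have [|k [a [q Dd]] mink] := @prop_minimum (fun k => exists (a : 'I_k -> M)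
    (q : 'I_k -> {mpoly C[N]}), d = \sum_(i < k) a i *: map_mpoly f (q i)).
  pose m i := nth 0%MM (msupp d) i.
  exists (size (msupp d)), (fun i => d@_(m i)), (fun i => 'X_[m i]).
  rewrite [LHS]mpolyE (big_nth 0%MM) big_mkord; apply: eq_bigr => i _.
  by rewrite map_mpolyX.
have free_a (g : 'I_k -> C) : \sum_i f (g i) * a i = 0 -> forall i, g i = 0.
  case: k => [|k] in a q Dd mink g *; first by move=> _ [].
  move=> rel i0; apply/eqP/negPn/negP => g0.
  suff : (k.+1 <= k)%N by rewrite ltnn.
  (* The relation eliminates [a i0], whose term is absorbed by the other [q i]: one term fewer. *)
  pose e i := g (lift i0 i) / g i0.
  apply: mink; exists (fun i => a (lift i0 i)), (fun i => q (lift i0 i) - e i *: q i0).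
  have a0 : a i0 = - \sum_i f (e i) * a (lift i0 i).
    apply: (mulfI (_ : f (g i0) != 0)); first by rewrite fmorph_eq0.
    apply/eqP; rewrite mulrN -addr_eq0 mulr_sumr -[X in _ == X]rel (bigD1_ord i0) //=.
    apply/eqP; congr (_ + _); apply: eq_bigr => i _.
    by rewrite /e mulrA -rmorphM [g i0 * _]mulrC divfK.
  rewrite Dd (bigD1_ord i0) //= a0 scaleNr scaler_suml addrC -sumrB.
  apply: eq_bigr => i _; rewrite rmorphB /= map_mpolyZ scalerBr scalerA.
  by rewrite [a _ * _]mulrC.
have [i qi] : exists i, mmap (h \o f) v (q i) != 0.
  apply: NNPP => no; case/negP: dv; rewrite Dd raddf_sum big1 //= => i _.
  rewrite mmapZ mmap_map_mpoly; have -> : mmap (h \o f) v (q i) = 0; last exact: mulr0.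
  by apply/eqP/negPn/negP => qi; apply: no; exists i.
exists (q i) => // c; apply: contra_neq => dc.
apply: (free_a (fun l => mmap idfun c (q l))).
rewrite -[RHS]dc Dd raddf_sum; apply: eq_bigr => l _ /=.
by rewrite mmapZ mmap_map_mpoly rmorph_mmap mulrC.
Qed.

(** * Polynomials in the entries of a matrix *)

Section MatrixEvaluation.
Variables (n : nat).

Definition mxpoint (R : Type) (V : 'M[R]_n) : 'I_(n * n) -> R := fun k => mxvec V 0 k.

Definition mxeval (A R : comNzRingType) (f : {rmorphism A -> R}) (V : 'M[R]_n)
  : {rmorphism {mpoly A[n * n]} -> R} := mmap f (mxpoint V).

Definition mxvar (R : comNzRingType) : 'M[{mpoly R[n * n]}]_n :=
  \matrix_(i, j) 'X_(mxvec_index i j).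

Lemma mxpoint_index (R : Type) (V : 'M[R]_n) i j : mxpoint V (mxvec_index i j) = V i j.
Proof. exact: mxvecE. Qed.

Lemma mxevalC (A R : comNzRingType) (f : {rmorphism A -> R}) V a :
  mxeval f V a%:MP = f a.
Proof. exact: mmapC. Qed.

Lemma mxevalX (A R : comNzRingType) (f : {rmorphism A -> R}) V i j :
  mxeval f V 'X_(mxvec_index i j) = V i j.
Proof. by rewrite [LHS]mmapX mmap1U mxpoint_index. Qed.

Lemma mxeval_unique (A R : comNzRingType) (g : {rmorphism {mpoly A[n * n]} -> R})
    (f : {rmorphism A -> R}) (V : 'M[R]_n) :
    (forall a, g a%:MP = f a) -> (forall i j, g 'X_(mxvec_index i j) = V i j) ->
  g =1 mxeval f V.
Proof.
move=> gC gX; apply: mmap_unique => // k.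
by case/mxvec_indexP: k => i j; rewrite gX mxpoint_index.
Qed.

Lemma rmorph_mxeval (A R S : comNzRingType) (g : {rmorphism R -> S})
    (f : {rmorphism A -> R}) V P :
  g (mxeval f V P) = mxeval (g \o f) (map_mx g V) P.
Proof.
apply: (mxeval_unique (g := g \o mxeval f V)) => [a|i j].
  by rewrite [LHS]/= [X in g X]mxevalC.
by rewrite [LHS]/= [X in g X]mxevalX mxE.
Qed.

Lemma map_mxeval_mxvar (R S : comNzRingType) (f : {rmorphism R -> S}) V :
  map_mx (mxeval f V) (mxvar R) = V.
Proof. by apply/matrixP => i j; rewrite !mxE mxevalX. Qed.

Lemma eq_mxeval (A R : comNzRingType) (f f' : {rmorphism A -> R}) V P :
  f =1 f' -> mxeval f V P = mxeval f' V P.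
Proof. by move=> eqf; apply: eq_mmap. Qed.

(** The polynomial P(Y V) in the entries of the matrix of indeterminates Y, which is [mxvar R]. *)
Definition mxsubst (A R : comNzRingType) (f : {rmorphism A -> R}) (V : 'M[R]_n)
  : {rmorphism {mpoly A[n * n]} -> {mpoly R[n * n]}} :=
  mxeval (@mpolyC _ _ \o f) (mxvar R *m map_mx (@mpolyC _ _) V).

Lemma mxeval_mxsubst (A R S : comNzRingType) (f : {rmorphism A -> R}) V
    (g : {rmorphism R -> S}) D P :
  mxeval g D (mxsubst f V P) = mxeval (g \o f) (D *m map_mx g V) P.
Proof.
rewrite rmorph_mxeval map_mxM map_mxeval_mxvar -map_mx_comp.
have -> : map_mx (mxeval g D \o @mpolyC _ _) V = map_mx g V.
  by apply/matrixP => i j; rewrite !mxE /= mxevalC.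
by apply: eq_mxeval => a; rewrite /= mxevalC.
Qed.

End MatrixEvaluation.

Lemma mmap_rename (A R : comNzRingType) n m (g : {rmorphism A -> R}) (v : 'I_m -> R)
    (w : 'I_n -> 'I_m) (Q : {mpoly A[n]}) :
  mmap g v (mmap (@mpolyC _ _) (fun i => 'X_(w i)) Q) = mmap g (v \o w) Q.
Proof.
rewrite rmorph_mmap; apply: eq_mmap => [a|i] /=; first by rewrite mmapC.
by rewrite mmapX mmap1U.
Qed.

(** [D] and [D'] are specialised jointly, as one point with [N + N] coordinates, so that [c] and
    [c'] inherit the relation [D *m D' = 1%:M]. *)
Lemma mx_specialization (F C : fieldType) (j : {rmorphism C -> F}) n (D D' : 'M[F]_n)
    (s : {mpoly C[n * n]}) :
    GRing.closed_field_axiom C -> D *m D' = 1%:M -> mxeval j D s != 0 ->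
  exists c c', [/\ c *m c' = 1%:M, mxeval idfun c s != 0,
    forall Q, mxeval j D Q = 0 -> mxeval idfun c Q = 0 &
    forall Q, mxeval j D' Q = 0 -> mxeval idfun c' Q = 0].
Proof.
move=> closedC DD' sD; set N := (n * n)%N.
pose v k := match split k with inl i => mxpoint D i | inr i => mxpoint D' i end.
have vl : v \o @lshift N N =1 mxpoint D.
  by move=> k; rewrite /v /= (unsplitK (inl _ k)).
have vr : v \o @rshift N N =1 mxpoint D'.
  by move=> k; rewrite /v /= (unsplitK (inr _ k)).
have [|r jr spec] := @mpoly_specialization F C closedC _ C j v
  (mmap (@mpolyC _ _) (fun i => 'X_(lshift N i)) s).
  by rewrite mmap_rename (eq_mmap _ (frefl _) vl).
have [b /eqP||c kerc sc] := spec idfun; first by rewrite fmorph_eq0 => /eqP.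
  by apply: contraNneq jr => /= ->; rewrite rmorph0.
pose mxof w : 'M[C]_n := vec_mx (\row_k c (w k)).
have mxofE w : c \o w =1 mxpoint (mxof w) by move=> k; rewrite /mxpoint vec_mxK mxE.
exists (mxof (@lshift N N)), (mxof (@rshift N N)); split.
- apply/matrixP => i k; apply/eqP; rewrite -subr_eq0; apply/eqP.
  pose rel : {mpoly C[N + N]} :=
    \sum_l 'X_(lshift N (mxvec_index i l)) * 'X_(rshift N (mxvec_index l k))
      - (i == k)%:R.
  have relE (R : comNzRingType) (g : {rmorphism C -> R}) w : mmap g w rel =
      \sum_l w (lshift N (mxvec_index i l)) * w (rshift N (mxvec_index l k))
        - (i == k)%:R.
    rewrite rmorphB rmorph_nat rmorph_sum; congr (_ - _); apply: eq_bigr => l _.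
    by rewrite rmorphM /= !mmapX !mmap1U.
  have := kerc rel; rewrite !relE => <-; first by rewrite !mxE; congr (_ - _);
    apply: eq_bigr => l _; rewrite !mxE.
  move/matrixP/(_ i k)/eqP: DD'; rewrite -subr_eq0 !mxE => /eqP DD'ik.
  rewrite -[RHS]DD'ik; congr (_ - _); apply: eq_bigr => l _.
  by rewrite -!mxpoint_index -vl -vr.
- by move: sc; rewrite mmap_rename (eq_mmap _ (frefl _) (mxofE _)).
- move=> Q QD; have := kerc (mmap (@mpolyC _ _) (fun i => 'X_(lshift N i)) Q).
  rewrite !mmap_rename (eq_mmap _ (frefl _) vl) (eq_mmap _ (frefl _) (mxofE _)).
  exact.
- move=> Q QD; have := kerc (mmap (@mpolyC _ _) (fun i => 'X_(rshift N i)) Q).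
  rewrite !mmap_rename (eq_mmap _ (frefl _) vr) (eq_mmap _ (frefl _) (mxofE _)).
  exact.
Qed.

(** * Polynomial relations of a differential system *)

Section CoefficientDerivation.
Variables (M : diffFieldType) (N : nat).
Local Notation coef_der := (map_mpoly (@der M)).

Lemma coef_derZ a (P : {mpoly M[N]}) :
  coef_der (a *: P) = der a *: P + a *: coef_der P.
Proof.
by apply/mpolyP => m; rewrite mcoeffD !mcoeffZ !mcoeff_map_mpoly mcoeffZ /= derM.
Qed.

Lemma coef_derX m : coef_der 'X_[m] = 0 :> {mpoly M[N]}.
Proof.
apply/mpolyP => m'; rewrite mcoeff_map_mpoly mcoeffX mcoeff0 /=.
case: (m == m'); last exact: raddf0.
by apply: (addrI (der (1 : M))); rewrite addr0 -[in RHS](mulr1 1) derM mulr1 mul1r.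
Qed.

Lemma coef_derM (P Q : {mpoly M[N]}) :
  coef_der (P * Q) = coef_der P * Q + P * coef_der Q.
Proof.
elim/mpoly_closed: P Q => [a|i|P1 P2 IH1 IH2|P1 P2 IH1 IH2] Q.
- have -> : coef_der a%:MP = (der a)%:MP :> {mpoly M[N]}.
    by apply/mpolyP => m; rewrite mcoeff_map_mpoly !mcoeffC /=; case: (_ == _);
      rewrite ?mulr1 ?mulr0 ?raddf0.
  by rewrite !mul_mpolyC coef_derZ.
- rewrite coef_derX mul0r add0r.
  elim/mpolyind: Q => [|a m Q _ _ IHQ]; first by rewrite mulr0 !raddf0 mulr0.
  rewrite mulrDr !raddfD /= mulrDr IHQ; congr (_ + _).
  by rewrite -scalerAr -mpolyXD !coef_derZ !coef_derX !scaler0 !addr0 -scalerAr mpolyXD.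
- by rewrite !mulrDl !raddfD /= IH1 IH2 mulrDl addrACA.
- by rewrite -mulrA !IH1 IH2 mulrDr mulrDl !mulrA addrA.
Qed.

End CoefficientDerivation.

(** [P'] is the derivative of [P] along the system V' = V B. Its independence of [R] and [d] allows
    its use both in [M] and in polynomials over [M] with the coefficientwise derivation. *)
Lemma mxeval_derivation (K : diffFieldType) n (B : 'M[K]_n) (P : {mpoly K[n * n]}) :
  exists P', forall (R : comNzRingType) (d : R -> R) (k : {rmorphism K -> R})
      (V : 'M[R]_n),
    {morph d : x y / x + y} -> (forall x y, d (x * y) = d x * y + x * d y) ->
    (forall a, d (k a) = k (der a)) -> map_mx d V = V *m map_mx k B ->
  d (mxeval k V P) = mxeval k V P'.
Proof.
elim/mpoly_closed: P => [a|i|P Q [P' IHP] [Q' IHQ]|P Q [P' IHP] [Q' IHQ]].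
- by exists (der a)%:MP => R d k V dD dM dk _; rewrite !mxevalC dk.
- case/mxvec_indexP: i => i j; exists ((mxvar n K *m map_mx (@mpolyC _ _) B) i j).
  move=> R d k V dD dM dk /matrixP/(_ i j); rewrite mxE mxevalX => ->.
  rewrite !mxE rmorph_sum; apply: eq_bigr => l _.
  by rewrite rmorphM !mxE mxevalX mxevalC.
- exists (P' + Q') => R d k V dD dM dk dV.
  by rewrite !rmorphD /= dD (IHP R d) // (IHQ R d).
- exists (P' * Q + P * Q') => R d k V dD dM dk dV.
  by rewrite rmorphD !rmorphM /= dM (IHP R d) // (IHQ R d).
Qed.

Section RelationSpan.
Variables (K M : diffFieldType) (iota : {rmorphism K -> M}).
Hypothesis iota_der : is_diff_morphism iota.
Variables (n : nat) (W : 'M[M]_n) (B : 'M[K]_n).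
Hypothesis derW : map_mx der W = W *m map_mx iota B.

Inductive relation_span : {mpoly M[n * n]} -> Prop :=
| relation_span_gen P : mxeval iota W P = 0 -> relation_span (mxsubst iota W P)
| relation_spanD P Q : relation_span P -> relation_span Q -> relation_span (P + Q)
| relation_spanZ a P : relation_span P -> relation_span (a *: P).

(** The coefficientwise derivation kills Y, so (Y W)' = Y W B and P(Y W)' = P'(Y W). This is again a
    generator, since P'(W) = P(W)' = 0. *)
Lemma relation_span_der P :
  relation_span P -> relation_span (map_mpoly der P).
Proof.
elim=> {P} [P PW|P Q _ IHP _ IHQ|a P spanP IHP].
- have [P' dP] := mxeval_derivation B P; rewrite (dP _ (map_mpoly der)).
  + apply: relation_span_gen; rewrite -(dP _ der) ?PW ?raddf0 //.
    * exact: derD.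
    * exact: derM.
  + exact: raddfD.
  + exact: coef_derM.
  + move=> a /=; apply/mpolyP => m; rewrite mcoeff_map_mpoly !mcoeffC /= iota_der.
    by case: (_ == _); rewrite ?mulr1 ?mulr0 ?raddf0.
  + apply/matrixP => i j; rewrite !mxE raddf_sum.
    under eq_bigr => l _ do rewrite /= coef_derM !mxE coef_derX mul0r add0r.
    have dWC k : map_mpoly der (W k j)%:MP
        = ((W *m map_mx iota B) k j)%:MP :> {mpoly M[n * n]}.
      rewrite -derW mxE; apply/mpolyP => m; rewrite mcoeff_map_mpoly !mcoeffC /=.
      by case: (_ == _); rewrite ?mulr1 ?mulr0 ?raddf0.
    under eq_bigr => l _ do rewrite dWC.
    transitivity ((mxvar n M *m map_mx (@mpolyC _ _) (W *m map_mx iota B)) i j).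
      rewrite mxE; apply: eq_bigr => l _.
      by rewrite [X in _ = _ * X]mxE [X in _ = X * _]mxE.
    rewrite map_mxM mulmxA !mxE; apply: eq_bigr => l _.
    by rewrite !mxE.
- by rewrite raddfD; apply: relation_spanD.
- by rewrite coef_derZ; apply: relation_spanD; apply: relation_spanZ.
Qed.

(** Transported by [h], P(Y W) takes at [D] the value h'(P(W)), so the whole span vanishes at [D].
    Its members with constant coefficients come from [C] and thus vanish at [c]; by [constant_span]
    all members do. *)
Lemma relation_specialization (C L : fieldType) (f : {rmorphism C -> M})
    (h h' : {rmorphism M -> L}) (D : 'M[L]_n) (c : 'M[C]_n) :
    (forall a, der a = 0 -> exists b, f b = a) ->
    h \o iota =1 h' \o iota -> map_mx h' W = D *m map_mx h W ->
    (forall Q, mxeval (h \o f) D Q = 0 -> mxeval idfun c Q = 0) ->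
  forall P, mxeval iota W P = 0 -> mxeval iota (map_mx f c *m W) P = 0.
Proof.
move=> constf hh' hW cD P /relation_span_gen spanP.
have -> : mxeval iota (map_mx f c *m W) P = mxeval idfun (map_mx f c) (mxsubst iota W P).
  by rewrite mxeval_mxsubst map_mx_id //; apply: eq_mxeval.
move: (mxsubst _ _ _) spanP => {}P spanP.
have spanD Q : relation_span Q -> mxeval h D Q = 0.
  elim=> {Q} [Q QW|Q1 Q2 _ IH1 _ IH2|a Q _ IH].
  - by rewrite mxeval_mxsubst -hW (eq_mxeval _ _ hh') -rmorph_mxeval QW rmorph0.
  - by rewrite rmorphD IH1 IH2 addr0.
  - by rewrite -mul_mpolyC rmorphM IH mulr0.
apply: (constant_span (J := relation_span)
  (S := fun P => mxeval idfun (map_mx f c) P = 0)) spanP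
  => [| | | | | |Q /spanD QD Qconst].
- exact: relation_spanD.
- exact: relation_spanZ.
- exact: relation_span_der.
- exact: rmorph0.
- by move=> P1 P2 Q1 Q2; rewrite rmorphD Q1 Q2 addr0.
- by move=> a P1 Q1; rewrite -mul_mpolyC rmorphM Q1 mulr0.
have [m|q Dq] := @mpoly_lift _ _ _ f Q; first exact: constf.
have qD : mxeval (h \o f) D q = 0 by rewrite -QD -Dq [RHS]mmap_map_mpoly.
rewrite -Dq [LHS]mmap_map_mpoly.
transitivity (f (mxeval idfun c q)); last by rewrite cD // rmorph0.
by rewrite rmorph_mxeval; apply: eq_mxeval.
Qed.

End RelationSpan.

(** * Picard-Vessiot extensions *)

Section PicardVessiot.
Variables (K M : diffFieldType) (iota : {rmorphism K -> M}).
Hypothesis iota_der : is_diff_morphism iota.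
Variables (n : nat) (u : 'I_n -> M).

Lemma wronskian_mx_der (a : 'I_n.+1 -> K) :
    a ord_max != 0 -> (forall i, lde_solution iota a (u i)) ->
  exists B, map_mx der (wronskian_mx u) = wronskian_mx u *m map_mx iota B.
Proof.
(* A companion matrix: differentiation shifts the columns by one, and the last column, [j.+1 == n],
   comes from solving the equation for the [n]-th derivative. *)
move=> an sol_u; exists (\matrix_(k, j) if j.+1 == n
  then - a (widen_ord (leqnSn n) k) / a ord_max else (k == j.+1 :> nat)%:R).
apply/matrixP => i j; rewrite !mxE.
case: (eqVneq j.+1 n) => [jn|jn].
  have := sol_u i; rewrite /lde_solution big_ord_recr /= => /eqP.
  rewrite addrC addr_eq0 => /eqP Dun; apply: (mulfI (_ : iota (a ord_max) != 0)).
    by rewrite fmorph_eq0.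
  have -> : der (iter j der (u i)) = iter n der (u i).
    exact: (congr1 (fun m => iter m der (u i)) jn).
  rewrite Dun -sumrN mulr_sumr; apply: eq_bigr => k _.
  rewrite !mxE jn eqxx /= -mulNr -rmorphN mulrCA -rmorphM.
  by rewrite [a ord_max * _]mulrC divfK // mulrC.
have lt_jn : (j.+1 < n)%N by rewrite ltn_neqAle jn ltn_ord.
rewrite (bigD1 (Ordinal lt_jn)) //= !mxE (negPf jn) eqxx rmorph1 mulr1.
rewrite big1 ?addr0 // => k ne_k; rewrite !mxE (negPf jn).
by have /negPf -> : (k != j.+1 :> nat) by []; rewrite rmorph0 mulr0.
Qed.

(** These fractions form a differential subfield containing [K] and the [u i]; stability under [der]
    comes from the system W' = W B. *)
Lemma diff_gen_fraction (B : 'M[K]_n) y :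
    map_mx der (wronskian_mx u) = wronskian_mx u *m map_mx iota B ->
    diff_gen iota u y ->
  exists P Q, mxeval iota (wronskian_mx u) Q != 0 /\
    y * mxeval iota (wronskian_mx u) Q = mxeval iota (wronskian_mx u) P.
Proof.
set W := wronskian_mx u; set ev := mxeval iota W => derW.
move=> /(_ (fun y => exists P Q, ev Q != 0 /\ y * ev Q = ev P)); apply.
- split.
  + by exists 1, 1; rewrite !rmorph1 mulr1 oner_neq0.
  + move=> x1 x2 [P1 [Q1 [Q1n0 x1Q]]] [P2 [Q2 [Q2n0 x2Q]]].
    exists (P1 * Q2 - P2 * Q1), (Q1 * Q2); rewrite rmorphB !rmorphM mulf_neq0 //.
    by split=> //; rewrite -x1Q -x2Q; ring.
  + move=> x1 x2 [P1 [Q1 [Q1n0 x1Q]]] [P2 [Q2 [Q2n0 x2Q]]].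
    exists (P1 * P2), (Q1 * Q2); rewrite !rmorphM mulf_neq0 //.
    by split=> //; rewrite -x1Q -x2Q; ring.
  + move=> x [P [Q [Qn0 xQ]]].
    have [->|xn0] := eqVneq x 0.
      by exists 0, 1; rewrite rmorph0 rmorph1 invr0 mul0r oner_neq0.
    by exists Q, P; rewrite -xQ mulf_neq0 // mulKf.
  + move=> x [P [Q [Qn0 xQ]]].
    have [P' dP] := mxeval_derivation B P; have [Q' dQ] := mxeval_derivation B Q.
    have {}dP : der (ev P) = ev P'.
      by apply: dP => //; [exact: derD | exact: derM].
    have {}dQ : der (ev Q) = ev Q'.
      by apply: dQ => //; [exact: derD | exact: derM].
    exists (P' * Q - P * Q'), (Q * Q); rewrite rmorphB !rmorphM mulf_neq0 //.
    by split=> //; rewrite -dP -dQ -xQ derM; ring.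
- by move=> a; exists a%:MP, 1; rewrite rmorph1 mulr1 oner_neq0 /ev mxevalC.
- move=> i; have n_gt0 : (0 < n)%N by apply: leq_ltn_trans (ltn_ord i).
  (* Column 0 of the wronskian matrix consists of the [u i] themselves. *)
  exists 'X_(mxvec_index i (Ordinal n_gt0)), 1.
  by rewrite rmorph1 mulr1 oner_neq0 /ev mxevalX mxE.
Qed.

End PicardVessiot.

Theorem mainTheorem3 (K : diffFieldType)
    (K_char0 : ([pchar K] =i pred0)%R)
    (K_closed : GRing.closed_field_axiom (constants K))
    (M : diffFieldType) (iota : {rmorphism K -> M})
    (iota_der : is_diff_morphism iota)
    (M_pv : picard_vessiot iota) :
  normal_extension iota.
Proof.
case: M_pv => [[n [a [u [[an sol_u wr_u] gen_u]]]] same_const] z zK.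
have [B derW] := wronskian_mx_der an sol_u.
have frac y := diff_gen_fraction iota_der derW (gen_u y).
set W := wronskian_mx u in wr_u derW frac.
pose f : {rmorphism constants K -> M} := iota \o val.
have constf x : der x = 0 -> exists b, f b = x.
  move=> dx; have /same_const[c cK <-] : x \in @is_constant M.
    by rewrite unfold_in; apply/eqP.
  by exists (Constant cK).
have [L [h1 [h2 [h12 hz]]]] := separating_embeddings K_char0 zK frac.
pose W1 := map_mx h1 W; pose W2 := map_mx h2 W.
have W1u : W1 \in unitmx by rewrite unitmxE unitfE det_map_mx fmorph_eq0.
have W2u : W2 \in unitmx by rewrite unitmxE unitfE det_map_mx fmorph_eq0.
pose D := W2 *m invmx W1; pose D' := W1 *m invmx W2.
have DW : W2 = D *m W1 by rewrite mulmxKV.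
have DW' : W1 = D' *m W2 by rewrite mulmxKV.
have DD' : D *m D' = 1%:M by rewrite /D /D' mulmxA mulmxKV // mulmxV.
have [P [Q [Qn0 zQ]]] := frac z.
(* With z = P(W) / Q(W), this is Q(W) P(Y W) - P(W) Q(Y W). Its value at [D] is a nonzero multiple
   of [h2 z - h1 z]; at [c] it will vanish if [sigma] fixes [z]. *)
pose d := (mxeval iota W Q)%:MP * mxsubst iota W P
  - (mxeval iota W P)%:MP * mxsubst iota W Q.
have evD R : mxeval h1 D (mxsubst iota W R) = h2 (mxeval iota W R).
  by rewrite mxeval_mxsubst -DW rmorph_mxeval; apply: eq_mxeval.
have dD : mxeval h1 D d != 0.
  rewrite rmorphB !rmorphM !mxevalC !evD -zQ !rmorphM.
  have -> : h1 (mxeval iota W Q) * (h2 z * h2 (mxeval iota W Q))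
      - h1 z * h1 (mxeval iota W Q) * h2 (mxeval iota W Q)
    = h1 (mxeval iota W Q) * h2 (mxeval iota W Q) * (h2 z - h1 z) by ring.
  by rewrite !mulf_neq0 ?fmorph_eq0 // subr_eq0 eq_sym.
have [s sD sc] := linear_specialization f dD.
have [c [c' [cc' cs cD c'D']]] := mx_specialization K_closed DD' sD.
have kc := relation_specialization iota_der derW constf h12 DW cD.
have kc' : forall R, mxeval iota W R = 0 -> mxeval iota (map_mx f c' *m W) R = 0.
  apply: (relation_specialization iota_der derW constf (fsym h12) DW') => R RD'.
  by apply: c'D'; rewrite -RD'; apply: eq_mxeval => b; apply: h12.
set cW := map_mx f c *m W in kc.
have kerc R : mxeval iota W R = 0 <-> mxeval iota cW R = 0.
  split=> [|RcW]; first exact: kc.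
  (* This is R(c Y): it vanishes at W, hence by [kc'] at c' W, where its value is R(c c' W) =
     R(W). *)
  pose R1 : {mpoly K[n * n]} := mxeval (@mpolyC _ _)
    (map_mx (@mpolyC _ _ \o val) c *m mxvar n K) R.
  have R1E V : mxeval iota V R1 = mxeval iota (map_mx f c *m V) R.
    rewrite rmorph_mxeval map_mxM map_mxeval_mxvar -map_mx_comp.
    have -> : map_mx (mxeval iota V \o (@mpolyC _ _ \o val)) c = map_mx f c.
      by apply/matrixP => i k; rewrite !mxE /= mxevalC.
    by apply: eq_mxeval => b; rewrite /= mxevalC.
  have := kc' R1; rewrite !R1E => /(_ RcW).
  by rewrite mulmxA -map_mxM cc' map_mx1 mul1mx.
have [sigma sE] := fraction_morphism kerc frac.
have {}sE R : sigma (mxeval iota W R) = mxeval iota cW R by exact: sE.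
have sK a0 : sigma (iota a0) = iota a0.
  by have := sE a0%:MP; rewrite !mxevalC.
have sW : map_mx sigma W = cW.
  apply/matrixP => i k; have := sE 'X_(mxvec_index i k).
  by rewrite !mxevalX => <-; rewrite [LHS]mxE.
(* The entries of [c] are constants, so c W solves the same system as W. *)
have der_cW : map_mx der cW = cW *m map_mx iota B.
  rewrite -mulmxA -derW; apply/matrixP => i k; rewrite !mxE raddf_sum.
  apply: eq_bigr => l _; rewrite /= derM !mxE /f /= -iota_der.
  have /eqP -> := valP (c i l).
  by rewrite rmorph0 mul0r add0r.
have s_der : is_diff_morphism sigma.
  have s_der_ev R : sigma (der (mxeval iota W R)) = der (sigma (mxeval iota W R)).
    have [R' dR] := mxeval_derivation B R.
    have dV V : map_mx der V = V *m map_mx iota B ->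
        der (mxeval iota V R) = mxeval iota V R'.
      by move=> derV; apply: dR => //; [exact: derD | exact: derM].
    by rewrite dV // !sE dV.
  (* Differentiating y S(W) = R(W) extends the commutation from polynomials in W to their
     quotients. *)
  move=> y; have [R [S [Sn0 yS]]] := frac y.
  have := s_der_ev R; rewrite -yS derM !rmorphM rmorphD !rmorphM derM s_der_ev.
  by move/addIr; apply: mulIf; rewrite fmorph_eq0.
have c'c : c' *m c = 1%:M by exact: mulmx1C.
(* The image of [sigma] is a differential subfield containing [K] and, as it sends c' W to c' c W =
   W, also the [u i]. The boolean equality lets [xchoose] define the inverse. *)
have s_surj y : exists x, sigma x == y.
  apply: (gen_u y (fun y => exists x, sigma x == y)).
  - split.
    + by exists 1; rewrite rmorph1.
    + by move=> _ _ [x1 /eqP <-] [x2 /eqP <-]; exists (x1 - x2); rewrite rmorphB.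
    + by move=> _ _ [x1 /eqP <-] [x2 /eqP <-]; exists (x1 * x2); rewrite rmorphM.
    + by move=> _ [x1 /eqP <-]; exists x1^-1; rewrite fmorphV.
    + by move=> _ [x1 /eqP <-]; exists (der x1); rewrite s_der.
  - by move=> b; exists (iota b); rewrite sK.
  - move=> i; have n_gt0 : (0 < n)%N by apply: leq_ltn_trans (ltn_ord i).
    exists ((map_mx f c' *m W) i (Ordinal n_gt0)).
    have : map_mx sigma (map_mx f c' *m W) = W.
      rewrite map_mxM sW mulmxA -map_mx_comp.
      have -> : map_mx (sigma \o f) c' = map_mx f c'.
        by apply/matrixP => k l; rewrite !mxE /= sK.
      by rewrite -map_mxM c'c map_mx1 mul1mx.
    by move/matrixP/(_ i (Ordinal n_gt0)); rewrite mxE => ->; rewrite mxE.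
exists sigma; split => //.
- exists (fun y => xchoose (s_surj y)) => y; last exact/eqP/(xchooseP (s_surj y)).
  exact/(fmorph_inj sigma)/eqP/(xchooseP (s_surj (sigma y))).
- have := sc _ cs; apply: contra_neq => sz.
  have -> : mmap idfun (f \o mxpoint c) d = mxeval idfun (map_mx f c) d.
    by apply: eq_mmap => // k; rewrite /mxpoint /= -map_mxvec mxE.
  have evc R : mxeval idfun (map_mx f c) (mxsubst iota W R) = sigma (mxeval iota W R).
    by rewrite mxeval_mxsubst map_mx_id // sE; apply: eq_mxeval.
  by rewrite rmorphB !rmorphM !mxevalC !evc -zQ !rmorphM sz /=; ring.
Qed.
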